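(* Let $n \ge 1$, let $F^2(\mathbb{R}^n)$ be the Bargmann-Fock space of real valued functions on $\mathbb{R}^n$, i.e. the reproducing kernel Hilbert space with kernel $K(x,y) = \exp(x^T y)$, and let $a \in \mathbb{R}$ with $|a| < 1$. There exists a collection of real coefficients $\{C_\alpha\}_{\alpha}$, indexed by the multi-indices $\alpha \in \mathbb{N}_0^n$, such that the following holds: if $f : \mathbb{R}^n \to \mathbb{R}^n$ is representable by a multi-variate power series $f(x) = \sum_{\alpha} f_\alpha x^\alpha$ satisfying $$\sum_{\alpha} |f_\alpha| C_\alpha < \infty,$$ then the scaled Liouville operator $A_{f,a}$ is bounded and compact over $F^2(\mathbb{R}^n)$.
   Context: A reproducing kernel Hilbert space (RKHS) over $\mathbb{R}^n$ is a Hilbert space $H$ of functions $\mathbb{R}^n \to \mathbb{R}$ for which every point evaluation is bounded. Its kernel is $K(x,y) = \langle k_y, k_x\rangle_H$, where $k_x \in H$ represents evaluation at $x$. The native space of a positive definite kernel is the unique RKHS with that kernel; $F^2(\mathbb{R}^n)$ is the native space of the exponential dot product kernel $\exp(x^T y)$. For an RKHS $H$ over $\mathbb{R}^n$, $a \in \mathbb{R}$ with $|a|<1$, and $f : \mathbb{R}^n \to \mathbb{R}^n$, the scaled Liouville operator with symbol $f$ is $A_{f,a} : \mathcal{D}(A_{f,a}) \to H$ given by $A_{f,a} g(x) = a \nabla g(ax) f(x)$ for all $x \in \mathbb{R}^n$ (with $\nabla g$ regarded as a row vector, so this is the dot product of $\nabla g(ax)$ with $f(x)$, times $a$), with domain $$\mathcal{D}(A_{f,a})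 = \{ h \in H : \text{the function } x \mapsto a \nabla h(ax) f(x) \text{ belongs to } H\}.$$ The coefficients $f_\alpha$ are vectors in $\mathbb{R}^n$, $|f_\alpha|$ denotes the Euclidean norm, and $x^\alpha = x_1^{\alpha_1}\cdots x_n^{\alpha_n}$. *)

(* Defs.v *)
From mathcomp Require Import all_boot all_order all_algebra.
From mathcomp Require Import all_classical all_reals all_analysis.
From mathcomp Require showcase.summability.

Set Implicit Arguments.
Unset Strict Implicit.
Unset Printing Implicit Defensive.

Import Order.TTheory GRing.Theory Num.Theory.
Import numFieldNormedType.Exports.

Local Open Scope classical_set_scope.
Local Open Scope ring_scope.

Section Rn.
Variables (R : realType) (n : nat).
Implicit Types x y : 'rV[R]_n.

Definition dotprod x y : R := (x *m y^T) 0 0.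

(* The library norm on ['rV[R]_n] is the maximum norm, hence this definition. *)
Definition enorm x : R := Num.sqrt (dotprod x x).

Definition grad (g : 'rV[R]_n -> R) x : 'rV[R]_n :=
  \row_(i < n) 'D_(delta_mx 0 i) g x.

Definition multiindex := {ffun 'I_n -> nat}.

Definition monomial (al : multiindex) x : R := \prod_(i < n) x 0 i ^+ al i.

(* Convergence at every point, along the net of finite sets of multi-indices. *)
Definition power_series_of (f : 'rV[R]_n -> 'rV[R]_n)
    (c : multiindex -> 'rV[R]_n) : Prop :=
  forall x, summability.partial_sum (fun al => monomial al x *: c al)
              @ summability.totally --> f x.

End Rn.

(* A Hilbert space of functions is presented as a complete inner product space
   together with a linear injection into the functions on R^n. *)
Record rkhs (R : realType) (n : nat) := Rkhs {
  rkhs_space :> completeNormedModType R;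
  inner : {dot rkhs_space for idfun};
  rkhs_normE : forall h : rkhs_space, `|h| ^+ 2 = inner h h;
  rkhs_fun : rkhs_space -> 'rV[R]_n -> R;
  rkhs_fun_linear : forall (b : R) (g h : rkhs_space) x,
    rkhs_fun (b *: g + h) x = b * rkhs_fun g x + rkhs_fun h x;
  rkhs_fun_inj : injective rkhs_fun;
  rkhs_eval_bounded : forall x, exists M : R,
    forall h : rkhs_space, `|rkhs_fun h x| <= M * `|h| }.

Section RKHS.
Variables (R : realType) (n : nat) (H : rkhs R n).

Definition represents_eval (x : 'rV[R]_n) (kx : H) : Prop :=
  forall h : H, rkhs_fun h x = inner H h kx.

Definition has_kernel (K : 'rV[R]_n -> 'rV[R]_n -> R) : Prop :=
  exists k : 'rV[R]_n -> H,
    (forall x, represents_eval x (k x)) /\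
    (forall x y, K x y = inner H (k y) (k x)).

Definition is_bargmann_fock : Prop :=
  has_kernel (fun x y => expR (dotprod x y)).

Variables (f : 'rV[R]_n -> 'rV[R]_n) (a : R).

Definition liouville_fun (g : 'rV[R]_n -> R) : 'rV[R]_n -> R :=
  fun x => a * dotprod (grad g (a *: x)) (f x).

(* ['D_v g x] is a default value when the limit does not exist, so that the
   existence of the gradients in the formula has to be required. *)
Definition liouville_dom : set H :=
  [set h | (forall x, differentiable (rkhs_fun h) (a *: x)) /\
           exists g : H, rkhs_fun g = liouville_fun (rkhs_fun h)].

(* On the domain, the element is unique since [rkhs_fun] is injective;
   the value outside of the domain is irrelevant. *)
Definition liouville_op (h : H) : H :=
  xget 0 [set g : H | rkhs_fun g = liouville_fun (rkhs_fun h)].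

End RKHS.

Arguments liouville_dom {R n} H f a.
Arguments liouville_op {R n} H f a h.

Section Operators.
Variables (R : realType) (V W : normedModType R).

(* An operator is given by a domain D and a map, meaningful only on D; a bounded
   or compact operator over V has to be defined on all of V. *)
Definition bounded_operator (D : set V) (A : V -> W) : Prop :=
  [/\ D = setT, linear A & exists M : R, forall h, `|A h| <= M * `|h|].

Definition compact_operator (D : set V) (A : V -> W) : Prop :=
  [/\ D = setT, linear A &
      forall B : set V, bounded_set B -> precompact (A @` B)].

End Operators.

(* Main.v *)
From HB Require Import structures.
Require Import Defs.
From mathcomp Require Import all_boot all_order all_algebra finmap.
From mathcomp Require Import all_classical all_reals all_analysis.
From mathcomp Require Import ring lra.
From mathcomp Require showcase.summability.

(* The monomials lie in the Bargmann-Fock space, with squared norm at most be!,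
   and h(x) = sum_be <h, x^be> / be! * x^be.  For each multi-index al and each i
   the operator (T h)(x) = a * x^al * (d_i h)(a x) is therefore a sum over be of
   operators of rank one and of norm at most a constant times
     |a|^|be| * be_i * sqrt ((be - e_i + al)! / be!),
   which is summable because |a| < 1.  So T is bounded and is a norm limit of
   operators of finite rank.  With C_al the sum over i of the norms of these
   operators, A_{f,a} is an absolutely convergent sum of them in operator norm. *)

Import Order.TTheory GRing.Theory Num.Theory.
Import numFieldNormedType.Exports.

Local Open Scope classical_set_scope.
Local Open Scope ring_scope.

(** The space is known only through its kernel, so that it contains the monomials has to be
    extracted from the expansion of [expR (dotprod x y)]: sending a combination of kernels to the
    same combination of values of a monomial is a bounded rule, and the Riesz theorem turns it into
    an element of the space. The domain of the Liouville operator has to be the whole space, so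
    every function of the space must be differentiable everywhere, with a gradient computed term by
    term; this comes from quadratic remainder bounds that are summable over the multi-indices. For
    fixed [al], the factor [be_i] and the root of the factorial ratio grow polynomially in the
    exponents. One square root of [|a| ^+ degree be] absorbs this growth, and the other one is left
    as a geometric series. Sums over multi-indices are limits along the net of finite sets, the same
    net as in the hypothesis on [f]. *)

Local Notation psum := summability.partial_sum.
Local Notation totally := summability.totally.
#[local] Existing Instance summability.totally_filter.

#[local] Set Implicit Arguments.
#[local] Unset Strict Implicit.
#[local] Unset Printing Implicit Defensive.

(** * Inner product, Cauchy-Schwarz and Riesz representation *)

Section InnerProduct.
Variables (R : realType) (n : nat) (H : rkhs R n).
Implicit Types u v w : H.

Local Notation "''[' u , v ]" := (inner H u v) : ring_scope.

Lemma innerC u v : '[u, v] = '[v, u].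
Proof. by rewrite hermC expr0 mul1r. Qed.

Lemma innerDl u v w : '[u + v, w] = '[u, w] + '[v, w].
Proof. exact: linearDl. Qed.

Lemma innerZl a u w : '[a *: u, w] = a * '[u, w].
Proof. exact: linearZl_LR. Qed.

Lemma innerDr u v w : '[w, u + v] = '[w, u] + '[w, v].
Proof. by rewrite innerC innerDl !(innerC w). Qed.

Lemma innerZr a u w : '[w, a *: u] = a * '[w, u].
Proof. by rewrite innerC innerZl (innerC w). Qed.

Lemma innerNl u w : '[- u, w] = - '[u, w].
Proof. by rewrite -scaleN1r innerZl mulN1r. Qed.

Lemma innerBl u v w : '[u - v, w] = '[u, w] - '[v, w].
Proof. by rewrite innerDl innerNl. Qed.

Lemma inner0l w : '[0, w] = 0.
Proof. by rewrite -(scale0r 0) innerZl mul0r. Qed.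

Lemma inner_suml (I : Type) (r : seq I) (F : I -> H) w :
  '[\sum_(i <- r) F i, w] = \sum_(i <- r) '[F i, w].
Proof.
by elim/big_rec2: _ => [|i _ v _ <-]; rewrite ?inner0l ?innerDl.
Qed.

Lemma inner_sumr (I : Type) (r : seq I) (F : I -> H) w :
  '[w, \sum_(i <- r) F i] = \sum_(i <- r) '[w, F i].
Proof. by rewrite innerC inner_suml; apply: eq_bigr => i _; rewrite innerC. Qed.

Lemma sqr_normD u v : `|u + v| ^+ 2 = `|u| ^+ 2 + 2 * '[u, v] + `|v| ^+ 2.
Proof.
by rewrite !rkhs_normE innerDl !innerDr (innerC v u); ring.
Qed.

Lemma sqr_normZ (t : R) u : `|t *: u| ^+ 2 = t ^+ 2 * `|u| ^+ 2.
Proof. by rewrite normrZ exprMn real_normK ?num_real. Qed.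

Lemma inner_le u v : `|'[u, v]| <= `|u| * `|v|.
Proof.
have [->|v0] := eqVneq v 0; first by rewrite innerC inner0l !normr0 mulr0.
have vp : 0 < `|v| ^+ 2 by rewrite exprn_gt0 // normr_gt0.
(* The vector is [u] minus its projection on [v]; expanding its squared norm gives the
   inequality. *)
have := sqr_ge0 `|u - ('[u, v] / `|v| ^+ 2) *: v|.
rewrite -scaleNr sqr_normD sqr_normZ innerZr sqrrN => Hq.
rewrite -(ler_pXn2r (n := 2)) ?nnegrE ?mulr_ge0 // exprMn real_normK ?num_real //.
rewrite -ler_pdivrMr // -subr_ge0; apply: le_trans Hq _.
rewrite le_eqVlt; apply/orP; left; apply/eqP; field.
by rewrite normr_eq0.
Qed.

Lemma inner_cvgl (I : Type) (F : set_system I) {FF : Filter F} (f : I -> H) u w :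
  f @ F --> u -> (fun i => '[f i, w]) @ F --> '[u, w].
Proof.
move=> fu; apply/cvgrPdist_le => e e0.
have w0 : 0 < `|w| + 1 by rewrite ltr_wpDl.
have /cvgrPdist_le/(_ _ (divr_gt0 e0 w0)) := fu.
apply: filterS => i Hi; rewrite -innerBl (le_trans (inner_le _ _)) //.
rewrite (le_trans (ler_wpM2r (normr_ge0 _) Hi)) // mulrAC ler_pdivrMr //.
by rewrite ler_wpM2l ?lerDl // ltW.
Qed.

Lemma inner_cvgr (I : Type) (F : set_system I) {FF : Filter F} (f : I -> H) u w :
  f @ F --> u -> (fun i => '[w, f i]) @ F --> '[w, u].
Proof.
by move=> /(@inner_cvgl _ _ _ _ _ w); rewrite innerC; under eq_fun do rewrite innerC.
Qed.

(* The functional whose graph is [G] is represented by the limit of a sequence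
   in the domain of [G] minimizing [`|v| ^+ 2 - 2 * r]. *)
Lemma riesz_representation (G : set (H * R)) (M : R) :
  G (0, 0) ->
  (forall v r v' r', G (v, r) -> G (v', r') -> G (v + v', r + r')) ->
  (forall t v r, G (v, r) -> G (t *: v, t * r)) ->
  (forall v r, G (v, r) -> r ^+ 2 <= M * `|v| ^+ 2) -> 0 <= M ->
  exists2 w : H, (forall v r, G (v, r) -> '[w, v] = r) & `|w| ^+ 2 <= M.
Proof.
move=> G0 GD GZ GM M0.
pose J (p : H * R) := `|p.1| ^+ 2 - 2 * p.2.
(* If [J p < - M], then [2 * r > X + M >= 0], so [(X + M) ^+ 2 < 4 * r ^+ 2 <= 4 * M * X], against
   [(X - M) ^+ 2 >= 0]. *)
have JM p : G p -> - M <= J p.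
  case: p => v r /GM; rewrite /J /=; set X := `|v| ^+ 2.
  have : 0 <= X by rewrite sqr_ge0.
  move: X => X X0 rX; rewrite leNgt; apply/negP => lt.
  have : (X + M) ^+ 2 < (2 * r) ^+ 2.
    by rewrite ltr_pXn2r // ?nnegrE; lra.
  have := sqr_ge0 (X - M); nra.
have Jinf : has_inf [set J p | p in G].
  by split; [exists (J (0, 0)); exists (0, 0)|
             exists (- M) => _ [p Gp <-]; exact: JM].
pose d := inf [set J p | p in G].
have dJ p : G p -> d <= J p.
  by move=> Gp; apply: ge_inf; [case: Jinf|exists p].
have /choice[p pP] (k : nat) : exists p, G p /\ J p < d + k.+1%:R^-1.
  have k0 : 0 < k.+1%:R^-1 :> R by rewrite invr_gt0.
  have [_ [p Gp <-] Jp] := inf_adherent k0 Jinf.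
  by exists p.
have GB q q' : G q -> G q' -> G (q - q').
  case: q q' => v r [v' r'] Gq Gq'; apply: (GD v r) => //.
  by have := GZ (-1) _ _ Gq'; rewrite scaleN1r mulN1r.
(* Parallelogram law: the midpoint of [q] and [q'] lies in [G], so [J] is at least [d] there. *)
have para q q' : G q -> G q' ->
    `|q.1 - q'.1| ^+ 2 <= 2 * (J q - d) + 2 * (J q' - d).
  case: q q' => v r [v' r'] Gq Gq' /=.
  have := dJ _ (GZ 2^-1 _ _ (GD _ _ _ _ Gq Gq')).
  have := sqr_normD v (- v'); have := sqr_normD v v'.
  rewrite /J /= sqr_normZ normrN (innerC v (- v')) innerNl (innerC v' v).
  move=> -> ->; have -> : 2^-1 ^+ 2 = 4^-1 :> R by field.
  by lra.
have cp : cauchy ((fst \o p) @ \oo).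
  apply: cauchy_exP => e e0.
  have e4 : 0 < e ^+ 2 / 4 by rewrite divr_gt0 // exprn_gt0.
  have [N _ HN] := near_infty_natSinv_lt (PosNum e4).
  exists (p N).1; exists N => // m /= Nm.
  rewrite -ball_normE /= -(ltr_pXn2r (n := 2)) ?nnegrE // ?(ltW e0) //.
  apply: le_lt_trans (para _ _ (pP N).1 (pP m).1) _.
  have JN k : (N <= k)%N -> J (p k) < d + e ^+ 2 / 4.
    by move=> Nk; apply: lt_trans (pP k).2 _; rewrite ltrD2l; exact: (HN k).
  have := JN N (leqnn N); have := JN m Nm.
  by lra.
have [w pw] : exists w : H, (fst \o p) @ \oo --> w.
  by exists (lim ((fst \o p) @ \oo)); apply: cauchy_cvg.
have wr v r : G (v, r) -> '[w, v] = r.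
  move=> Gvr.
  (* First variation: compare [J] at [p k + t *: (v, r)] with the infimum and let [k] tend to
     infinity. *)
  have qd t : 0 <= 2 * t * ('[w, v] - r) + t ^+ 2 * `|v| ^+ 2.
    have lim1 : (fun k => k.+1%:R^-1 + (2 * t * ('[(fst \o p) k, v] - r) + t ^+ 2 * `|v| ^+ 2))
        @ \oo --> 0 + (2 * t * ('[w, v] - r) + t ^+ 2 * `|v| ^+ 2).
      apply: cvgD; first exact: cvg_harmonic.
      apply: cvgD; last exact: cvg_cst.
      apply: cvgMr; apply: cvgB; last exact: cvg_cst.
      exact: inner_cvgl pw.
    rewrite add0r in lim1.
    apply: (cvgr_to_ge lim1); near=> k.
    have [Gk Jk] := pP k; move: Gk Jk => /=.
    case: (p k) => vk rk Gk Jk.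
    have := dJ _ (GD _ _ _ _ Gk (GZ t _ _ Gvr)); move: Jk.
    rewrite /J /= sqr_normD sqr_normZ innerZr.
    by move: (k.+1%:R^-1) => K h1 h2; lra.
  apply/eqP; rewrite -subr_eq0; apply/eqP.
  set D := _ - r in qd *.
  (* This [t] makes the quadratic a negative multiple of [D ^+ 2]; the added 1 covers [v = 0]. *)
  have := qd (- D / (1 + `|v| ^+ 2)).
  have : 0 <= `|v| ^+ 2 by rewrite sqr_ge0.
  move: (`|v| ^+ 2) => X X0.
  have -> : 2 * (- D / (1 + X)) * D + (- D / (1 + X)) ^+ 2 * X =
    - (D ^+ 2) * ((2 + X) / (1 + X) ^+ 2) by field; lra.
  rewrite mulNr oppr_ge0 pmulr_lle0; last by rewrite divr_gt0 ?exprn_gt0; lra.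
  move=> D0; apply/eqP; rewrite -sqrf_eq0 eq_le D0 sqr_ge0 //.
exists w => //.
(* [w] is only a limit of points of the domain, so the bound is applied at [p k], where the inner
   product with [w] is the value of the functional, and passed to the limit. *)
have w4 : `|w| ^+ 2 * `|w| ^+ 2 <= M * `|w| ^+ 2.
  have L : (fun k => M * `|(fst \o p) k| ^+ 2 - '[w, (fst \o p) k] ^+ 2) @ \oo -->
     M * `|w| ^+ 2 - '[w, w] ^+ 2.
    apply: cvgB; first by apply: cvgMr; apply: cvgM; exact: cvg_norm.
    by apply: cvgM; exact: inner_cvgr.
  rewrite -rkhs_normE in L; rewrite -expr2 -subr_ge0.
  apply: (cvgr_to_ge L); near=> k => /=.
  have [Gk _] := pP k; move: Gk.
  by case: (p k) => vk rk Gk /=; rewrite (wr _ _ Gk) subr_ge0 GM.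
have [w0|w0] := eqVneq (`|w| ^+ 2) 0; first by rewrite w0.
by rewrite -(ler_pM2r (x := `|w| ^+ 2)) // lt_def w0 sqr_ge0.
Unshelve. all: end_near.
Qed.
End InnerProduct.

(** * Unconditional sums dominated by a family with bounded finite sums *)

Section UnconditionalSums.
Variables (R : realType) (I : choiceType).

Lemma psumE (V : zmodType) (F : I -> V) (A : {fset I}) :
  psum F A = \sum_(i <- A) F i.
Proof. by rewrite big_seq_fsetE. Qed.

Lemma psum_subset (V : zmodType) (F : I -> V) (A B : {fset I}) :
  (A `<=` B)%fset -> psum F B = psum F A + psum F (B `\` A)%fset.
Proof.
move=> AB; rewrite !psumE (big_fsetID _ (mem A)) /=.
congr (_ + _); apply: eq_fbigl => i; rewrite !inE.
  by rewrite andbC; case: (boolP (i \in A)) => //= /(fsubsetP AB).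
by rewrite andbC.
Qed.

Lemma near_totally (A : {fset I}) : \forall B \near totally, (A `<=` B)%fset.
Proof. by exists A. Qed.

Variable (G : I -> R) (M : R).
Hypothesis psumG_le : forall A : {fset I}, psum G A <= M.

(** Take [A] with partial sum within [e] of the supremum of all partial sums: a larger set gains at
    most [e]. *)
Lemma psum_tail_small (e : R) : 0 < e ->
  exists A : {fset I}, forall B, (A `<=` B)%fset -> psum G (B `\` A)%fset <= e.
Proof.
move=> e0.
have hs : has_sup (range (psum G)).
  by split; [exists (psum G fset0), fset0|exists M => _ [A _ <-]].
have [_ [A _ <-] HA] := sup_adherent e0 hs.
exists A => B AB.
have : psum G B <= sup (range (psum G)) by apply: sup_upper_bound; [|exists B].
by rewrite (psum_subset _ AB); lra.
Qed.

Section Dominated.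
Variables (V : completeNormedModType R) (F : I -> V) (c : R).
Hypothesis F_le : forall i, `|F i| <= c * G i.

Lemma norm_psum_le A : `|psum F A| <= c * psum G A.
Proof.
rewrite !psumE mulr_sumr; apply: le_trans (ler_norm_sum _ _ _) _.
by apply: ler_sum => i _.
Qed.

Lemma psum_cvg : 0 <= c -> exists s : V, psum F @ totally --> s.
Proof.
move=> c0; exists (lim (psum F @ totally)); apply: cauchy_cvg.
apply: cauchy_exP => e e0.
have c1 : 0 < c + 1 by rewrite ltr_wpDl.
have [A HA] := psum_tail_small (divr_gt0 e0 c1).
exists (psum F A); apply: filterS (near_totally A) => B AB /=.
rewrite -ball_normE /= (psum_subset _ AB) opprD addNKr normrN.
apply: le_lt_trans (norm_psum_le _) _.
apply: le_lt_trans (ler_wpM2l c0 (HA _ AB)) _.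
by rewrite mulrCA gtr_pMr // ltr_pdivrMr // mul1r ltrDl.
Qed.

Lemma psum_lim_le (s : V) : 0 <= c -> psum F @ totally --> s -> `|s| <= c * M.
Proof.
move=> c0 /cvg_norm Fs; apply: (cvgr_to_le Fs); apply: nearW => A.
by apply: le_trans (norm_psum_le _) _; apply: ler_wpM2l.
Qed.

Lemma psum_lim_tail (e : R) A (s : V) : 0 <= c ->
  (forall B, (A `<=` B)%fset -> psum G (B `\` A)%fset <= e) ->
  psum F @ totally --> s -> `|s - psum F A| <= c * e.
Proof.
move=> c0 HA Fs.
have L : (fun B => `|psum F B - psum F A|) @ totally --> `|s - psum F A|.
  by apply: cvg_norm; apply: cvgB => //; exact: cvg_cst.
apply: (cvgr_to_le L); apply: filterS (near_totally A) => B AB /=.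
rewrite (psum_subset _ AB) addrAC subrr add0r.
by apply: le_trans (norm_psum_le _) _; apply: ler_wpM2l => //; exact: HA.
Qed.
End Dominated.
End UnconditionalSums.

(** * Sums over multi-indices: cubes, products, geometric series *)

Section Multiindices.
Variables (R : realType) (n : nat).
Implicit Types be : multiindex n.

(** Cubes are cofinal among the finite sets, and over a cube a sum of products factorizes into a
    product of sums. *)
Definition box N : {fset multiindex n} :=
  [fset ([ffun i => val (b i)] : multiindex n) | b : {ffun 'I_n -> 'I_N} in predT]%fset.

Lemma mem_box N be : (be \in box N) = [forall i, be i < N]%N.
Proof.
apply/imfsetP/forallP => /= [[b _ ->] i|beN]; first by rewrite ffunE.
exists [ffun i => Ordinal (beN i)] => //.
by apply/ffunP => i; rewrite !ffunE.
Qed.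

Lemma box_cofinal (A : {fset multiindex n}) : exists N, (A `<=` box N)%fset.
Proof.
exists (\max_(be <- A) \sum_i be i).+1; apply/fsubsetP => be beA.
rewrite mem_box; apply/forallP => i; rewrite ltnS.
apply: leq_trans (leq_bigmax_seq _ beA _) => //.
by rewrite (bigD1 i) //= leq_addr.
Qed.

Lemma box_cvg : box @ \oo --> totally.
Proof.
move=> P [A _ AP]; have [N AN] := box_cofinal A.
exists N => // m /= Nm; apply: AP => /=.
apply: fsubset_trans AN _; apply/fsubsetP => be; rewrite !mem_box.
by move=> /forallP H; apply/forallP => i; exact: leq_trans (H i) _.
Qed.

Lemma psum_box (t : 'I_n -> nat -> R) N :
  psum (fun be => \prod_i t i (be i)) (box N) = \prod_i \sum_(j < N) t i j.
Proof.
rewrite psumE big_imfset /=; last first.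
  move=> b b' _ _ /ffunP E; apply/ffunP => i; apply/val_inj.
  by have := E i; rewrite !ffunE.
rewrite bigA_distr_bigA /= big_enum /=.
by apply: eq_bigr => b _; apply: eq_bigr => i _; rewrite ffunE.
Qed.

(** Nonnegativity allows enlarging [A] to a cube, where the sum factorizes. *)
Lemma psum_prod_le (t : 'I_n -> nat -> R) (T : R) (A : {fset multiindex n}) :
  (forall i j, 0 <= t i j) -> (forall i N, \sum_(j < N) t i j <= T) ->
  psum (fun be => \prod_i t i (be i)) A <= T ^+ n.
Proof.
move=> t0 tT; have [N AN] := box_cofinal A.
have p0 B : 0 <= psum (fun be => \prod_i t i (be i)) B.
  by rewrite psumE sumr_ge0 // => be _; exact: prodr_ge0.
apply: (@le_trans _ _ (psum (fun be => \prod_i t i (be i)) (box N))).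
  by rewrite (psum_subset _ AN) lerDl.
rewrite psum_box; apply: (@le_trans _ _ (\prod_(i < n) T)).
  by apply: ler_prod => i _; rewrite tT sumr_ge0.
by rewrite prodr_const card_ord.
Qed.

Definition degree be : nat := \sum_i be i.

Lemma psum_geometric_le (r : R) (A : {fset multiindex n}) :
  0 <= r -> r < 1 -> psum (fun be => r ^+ degree be) A <= (1 - r)^-1 ^+ n.
Proof.
move=> r0 r1.
have -> : psum (fun be => r ^+ degree be) A =
          psum (fun be => \prod_i r ^+ be i) A.
  by rewrite !psumE; apply: eq_bigr => be _; rewrite prodrXr.
apply: (psum_prod_le (t := fun _ j => r ^+ j)) => [i j|_ N].
  by rewrite exprn_ge0.
have r1' : 0 < 1 - r by rewrite subr_gt0.
rewrite -div1r ler_pdivlMr // mulrC -opprB mulNr -subrX1 opprB.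
by rewrite lerBlDr lerDl exprn_ge0.
Qed.

Lemma psum_geometric_cvg (V : completeNormedModType R) (F : multiindex n -> V)
    (r c : R) : 0 <= r -> r < 1 -> 0 <= c ->
  (forall be, `|F be| <= c * r ^+ degree be) ->
  exists s : V, psum F @ totally --> s.
Proof.
move=> r0 r1 c0 Fr.
exact: (psum_cvg (fun A => psum_geometric_le A r0 r1) Fr c0).
Qed.
End Multiindices.

(** * Factorial and monomial estimates; expansion of the kernel *)

Section MultiindexBounds.
Variables (R : realType) (n : nat).
Implicit Types (x y : 'rV[R]_n) (be : multiindex n).

Lemma exprn_fact_le (z : R) j : 0 <= z -> z ^+ j / j`!%:R <= expR z.
Proof.
case: j => [|j] z0; first by rewrite expr0 divr1 -expR0 ler_expR.
by apply: le_trans (expR_ge1Dxn j z0); rewrite lerDr.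
Qed.

(** Apply the previous bound at [(2 * z) ^+ 2] and take square roots: the factor 2 becomes the
    geometric decay. *)
Lemma exprn_sqrt_fact_le (z : R) : 0 <= z ->
  exists2 B, 0 <= B &
    forall j, z ^+ j / Num.sqrt j`!%:R <= B * 2^-1 ^+ j.
Proof.
move=> z0; exists (Num.sqrt (expR ((2 * z) ^+ 2))) => // j.
rewrite exprVn ler_pdivlMr ?exprn_gt0 // mulrAC -exprMn.
have h0 : 0 <= (z * 2) ^+ j by rewrite exprn_ge0 // mulr_ge0.
rewrite -(ger0_norm h0) -sqrtr_sqr -sqrtrV ?ler0n // -sqrtrM ?sqr_ge0 //.
rewrite ler_wsqrtr // exprAC [z * 2]mulrC.
by rewrite exprn_fact_le // sqr_ge0.
Qed.

Definition mfact be : R := \prod_i (be i)`!%:R.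

Lemma mfact_gt0 be : 0 < mfact be.
Proof. by apply: prodr_gt0 => i _; rewrite ltr0n fact_gt0. Qed.

Lemma sqrtr_prod (I : Type) (r : seq I) (f : I -> R) : (forall i, 0 <= f i) ->
  Num.sqrt (\prod_(i <- r) f i) = \prod_(i <- r) Num.sqrt (f i).
Proof.
move=> f0; elim: r => [|i r IH]; first by rewrite !big_nil sqrtr1.
by rewrite !big_cons sqrtrM // IH.
Qed.

(** This dominates all Taylor series below: a coefficient costs [1 / Num.sqrt (mfact be)], a
    monomial at most [z ^+ degree be]. *)
Lemma degree_sqrt_mfact_le (z : R) : 0 <= z ->
  exists2 B, 0 <= B &
    forall be, z ^+ degree be / Num.sqrt (mfact be) <= B * 2^-1 ^+ degree be.
Proof.
move=> z0; have [B B0 HB] := exprn_sqrt_fact_le z0.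
exists (B ^+ n) => [|be]; first exact: exprn_ge0.
rewrite /mfact sqrtr_prod // -!prodrXr -[n in B ^+ n]card_ord -prodr_const.
rewrite -prodfV -!big_split /=; apply: ler_prod => i _.
by rewrite HB andbT divr_ge0 ?exprn_ge0.
Qed.

Lemma ler_norm_coord x i : `|x 0 i| <= `|x|.
Proof.
rewrite [leRHS]/Num.norm /= mx_normrE; apply/bigmax_geP; right => /=.
by exists (0, i).
Qed.

Lemma norm_monomial_le be x (z : R) : `|x| <= z -> `|monomial be x| <= z ^+ degree be.
Proof.
move=> xz; rewrite /monomial normr_prod -prodrXr; apply: ler_prod => i _.
rewrite normr_ge0 normrX /= lerXn2r ?nnegrE //.
  exact: le_trans (normr_ge0 _) xz.
exact: le_trans (ler_norm_coord _ _) xz.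
Qed.

(** Domination by a product of exponential series gives a limit along the finite sets. Along the
    cubes the partial sums are products of exponential partial sums, which identifies this limit. *)
Lemma expR_dotprod_psum x y :
  psum (fun be => monomial be x * monomial be y / mfact be) @ totally
    --> expR (dotprod x y).
Proof.
pose t i j := (x 0 i * y 0 i) ^+ j / j`!%:R.
have tE be : monomial be x * monomial be y / mfact be = \prod_i t i (be i).
  rewrite /monomial /mfact -prodfV -!big_split /=.
  by apply: eq_bigr => i _; rewrite /t exprMn.
have cvg_t i : (fun N => \sum_(j < N) t i j) @ \oo --> expR (x 0 i * y 0 i).
  apply: cvg_trans (is_cvg_series_exp_coeff (x 0 i * y 0 i)); apply: near_eq_cvg.
  by apply: nearW => N; rewrite /series /= big_mkord.
have B N i : \sum_(j < N) `|t i j| <= expR (`|x| * `|y|).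
  have z0 : 0 <= `|x| * `|y| by rewrite mulr_ge0.
  have nd : nondecreasing_seq (series (exp_coeff (`|x| * `|y|))).
    by apply: nondecreasing_series => j _ _; exact: exp_coeff_ge0.
  apply: le_trans (nondecreasing_cvgn_le nd (is_cvg_series_exp_coeff _) N).
  rewrite /series /= big_mkord; apply: ler_sum => j _.
  rewrite /t normrM normfV normr_nat normrX ler_wpM2r // lerXn2r ?nnegrE //.
  by rewrite normrM ler_pM // ler_norm_coord.
have [s Fs] : exists s : R,
    psum (fun be => monomial be x * monomial be y / mfact be) @ totally --> s.
  apply: (@psum_cvg _ _ (fun be => \prod_i `|t i (be i)|)
    (expR (`|x| * `|y|) ^+ n) _ _ _ 1) => //.
    by move=> A; apply: (psum_prod_le (t := fun i j => `|t i j|)) => // i N; apply: B.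
  by move=> be; rewrite mul1r tE normr_prod.
suff <- : s = expR (dotprod x y) by [].
have L1 := cvg_comp _ _ (@box_cvg n) Fs.
have L2 : (fun N => \prod_i \sum_(j < N) t i j) @ \oo --> \prod_i expR (x 0 i * y 0 i).
  by apply: cvg_big => //; exact: mul_continuous.
have -> : dotprod x y = \sum_i x 0 i * y 0 i.
  by rewrite /dotprod mxE; apply: eq_bigr => i _; rewrite mxE.
rewrite expR_sum; apply: (cvg_unique _ L1) => //.
apply: cvg_trans L2; apply: near_eq_cvg; apply: nearW => N /=.
by rewrite -psum_box !psumE; apply: eq_bigr => be _; rewrite tE.
Qed.

End MultiindexBounds.

(** * Monomials and Taylor expansions in the Bargmann-Fock space *)

Section BargmannFock.
Variables (R : realType) (n : nat) (H : rkhs R n).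
Variables (k : 'rV[R]_n -> H).
Hypothesis k_eval : forall x, represents_eval x (k x).
Hypothesis k_inner : forall x y, expR (dotprod x y) = inner H (k y) (k x).
Implicit Types (x y : 'rV[R]_n) (be : multiindex n).
Local Notation "''[' u , v ]" := (inner H u v) : ring_scope.

(* The bound [r ^+ 2 <= mfact be * `|v| ^+ 2] on finite combinations of kernels:
   [`|v| ^+ 2] is a sum of squares over all multi-indices, by the expansion of
   the kernel, and the term of index [be] is [r ^+ 2 / mfact be]. *)
Lemma monomial_in_space be : exists2 w : H,
  forall x, rkhs_fun w x = monomial be x & `|w| ^+ 2 <= mfact R be.
Proof.
pose comb (g : multiindex n) (s : seq (R * 'rV[R]_n)) : R :=
  \sum_(p <- s) p.1 * monomial g p.2.
pose vec (s : seq (R * 'rV[R]_n)) : H := \sum_(p <- s) p.1 *: k p.2.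
(* A graph, since one vector may come from several combinations of kernels; that they give the same
   value follows from the bound. *)
pose G : set (H * R) := [set q | exists s, q = (vec s, comb be s)].
have [|||||w wG wM] := @riesz_representation _ _ H G (mfact R be).
- by exists [::]; rewrite /vec /comb !big_nil.
- move=> _ _ _ _ [s [-> ->]] [s' [-> ->]]; exists (s ++ s').
  by rewrite /vec /comb !big_cat.
- move=> t _ _ [s [-> ->]]; exists [seq (t * p.1, p.2) | p <- s].
  rewrite /vec /comb !big_map scaler_sumr mulr_sumr.
  by congr pair; apply: eq_bigr => p _ /=; rewrite ?scalerA ?mulrA.
- move=> _ _ [s [-> ->]].
  have L : psum (fun g => comb g s ^+ 2 / mfact R g) @ totally --> `|vec s| ^+ 2.
    have -> : `|vec s| ^+ 2 = \sum_(p <- s) \sum_(q <- s)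
        p.1 * (q.1 * expR (dotprod q.2 p.2)).
      rewrite rkhs_normE inner_suml; apply: eq_bigr => p _.
      rewrite innerZl inner_sumr mulr_sumr; apply: eq_bigr => q _.
      by rewrite innerZr k_inner.
    have -> : psum (fun g => comb g s ^+ 2 / mfact R g) =
        (fun A => \sum_(p <- s) \sum_(q <- s) p.1 * (q.1 *
          psum (fun g => monomial g q.2 * monomial g p.2 / mfact R g) A)).
      apply/funext => A; rewrite psumE.
      under [RHS]eq_bigr => p _ do
        under eq_bigr => q _ do rewrite psumE mulrA mulr_sumr.
      under [RHS]eq_bigr => p _ do rewrite exchange_big /=.
      rewrite exchange_big /=; apply: eq_bigr => g _.
      rewrite expr2 {1}/comb !mulr_suml; apply: eq_bigr => p _.
      rewrite /comb mulr_sumr mulr_suml; apply: eq_bigr => q _.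
      by rewrite !mulrA; congr (_ / _); ring.
    apply: cvg_big => [|p _]; first exact: add_continuous.
    apply: cvg_big => [|q _]; first exact: add_continuous.
    by apply: cvgMr; apply: cvgMr; exact: expR_dotprod_psum.
  rewrite mulrC -ler_pdivrMr ?mfact_gt0 //.
  apply: (cvgr_to_ge L); apply: filterS (near_totally [fset be]%fset) => A.
  rewrite fsub1set => beA; rewrite psumE (big_fsetD1 be) //= lerDl.
  by apply: sumr_ge0 => g _; rewrite divr_ge0 ?sqr_ge0 // ltW // mfact_gt0.
- exact/ltW/mfact_gt0.
exists w => // x; rewrite k_eval; apply: wG; exists [:: (1, x)].
by rewrite /vec /comb !big_seq1 scale1r mul1r.
Qed.

Variable mon : multiindex n -> H.
Hypothesis monE : forall be x, rkhs_fun (mon be) x = monomial be x.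
Hypothesis mon_norm : forall be, `|mon be| ^+ 2 <= mfact R be.

Lemma norm_mon_le be : `|mon be| <= Num.sqrt (mfact R be).
Proof.
by rewrite -[leLHS]ger0_norm // -sqrtr_sqr ler_wsqrtr.
Qed.

Lemma rkhs_fun_sum (I : Type) (r : seq I) (F : I -> H) x :
  rkhs_fun (\sum_(i <- r) F i) x = \sum_(i <- r) rkhs_fun (F i) x.
Proof. by rewrite k_eval inner_suml; apply: eq_bigr => i _; rewrite k_eval. Qed.

Lemma rkhs_funZ a (h : H) x : rkhs_fun (a *: h) x = a * rkhs_fun h x.
Proof. by rewrite !k_eval innerZl. Qed.

Lemma rkhs_fun_cvg (I : Type) (F : set_system I) {FF : Filter F} (f : I -> H)
    (h : H) x : f @ F --> h -> (fun i => rkhs_fun (f i) x) @ F --> rkhs_fun h x.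
Proof.
by move=> fh; under eq_fun do rewrite k_eval; rewrite k_eval; exact: inner_cvgl.
Qed.

Definition taylor_coef (h : H) be : R := '[h, mon be] / mfact R be.

Lemma taylor_coef_le h be : `|taylor_coef h be| <= `|h| / Num.sqrt (mfact R be).
Proof.
have m0 := mfact_gt0 R be; have s0 : 0 < Num.sqrt (mfact R be) by rewrite sqrtr_gt0.
rewrite /taylor_coef normrM normfV (gtr0_norm m0) -{1}(sqr_sqrtr (ltW m0)).
rewrite expr2 invfM mulrA ler_wpM2r ?invr_ge0 ?(ltW s0) //.
rewrite ler_pdivrMr //; apply: le_trans (inner_le _ _) _.
by rewrite ler_wpM2l // norm_mon_le.
Qed.

(** The terms have norm at most [|x| ^+ degree be / Num.sqrt (mfact be)], so the series converges in
    norm. Its sum is recognised by evaluation at every [z], which yields the exponential series. *)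
Lemma kernel_expansion x :
  psum (fun be => (monomial be x / mfact R be) *: mon be) @ totally --> k x.
Proof.
have [B B0 HB] := degree_sqrt_mfact_le n (normr_ge0 x).
have [||//||s Fs] := @psum_geometric_cvg _ _ H
  (fun be => (monomial be x / mfact R be) *: mon be) 2^-1 B.
- by lra.
- by lra.
- move=> be; apply: le_trans _ (HB be).
  have m0 := mfact_gt0 R be; have s0 : 0 < Num.sqrt (mfact R be) by rewrite sqrtr_gt0.
  rewrite normrZ normrM normfV (gtr0_norm m0) -mulrA.
  rewrite ler_pM ?mulr_ge0 ?invr_ge0 ?(ltW m0) //; first exact: norm_monomial_le.
  rewrite mulrC ler_pdivrMr // -{2}(sqr_sqrtr (ltW m0)) expr2 mulKf ?gt_eqF //.
  exact: norm_mon_le.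
suff <- : s = k x by [].
apply: rkhs_fun_inj; apply/funext => z.
have -> : rkhs_fun (k x) z = expR (dotprod x z).
  by rewrite k_eval k_inner innerC.
pose F be := (monomial be x / mfact R be) *: mon be.
have L : (fun A => rkhs_fun (psum F A) z) @ totally --> rkhs_fun s z.
  exact: rkhs_fun_cvg.
suff E : (fun A => rkhs_fun (psum F A) z) =
    psum (fun be => monomial be x * monomial be z / mfact R be).
  rewrite E in L; apply: (cvg_unique _ L) => //; exact: expR_dotprod_psum.
apply/funext => A; rewrite !psumE rkhs_fun_sum; apply: eq_bigr => be _.
by rewrite rkhs_funZ monE mulrAC.
Qed.

(** Pair the expansion of [k x] with [h]. *)
Lemma rkhs_fun_expansion (h : H) x :
  psum (fun be => taylor_coef h be * monomial be x) @ totally --> rkhs_fun h x.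
Proof.
rewrite k_eval.
suff -> : psum (fun be => taylor_coef h be * monomial be x) =
    (fun A => '[h, psum (fun be => (monomial be x / mfact R be) *: mon be) A]).
  by apply: inner_cvgr; exact: kernel_expansion.
apply/funext => A.
rewrite !psumE inner_sumr; apply: eq_bigr => be _.
by rewrite innerZr /taylor_coef mulrC mulrAC mulrA.
Qed.

End BargmannFock.

(** * Second-order expansions with controlled coefficients *)

Section Jets.
Variable (R : realType).

(* A second-order expansion [A = A0 + s * A1 + s ^+ 2 * A2] with a bound [c] on
   the sum of the absolute values of its coefficients: such bounds multiply. *)
Definition jet (s c A A0 A1 : R) :=
  exists2 A2, A = A0 + s * A1 + s ^+ 2 * A2 & `|A0| + `|A1| + `|A2| <= c.

Lemma jetM s c d A A0 A1 B B0 B1 : 0 <= s -> s <= 1 ->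
  jet s c A A0 A1 -> jet s d B B0 B1 ->
  jet s (c * d) (A * B) (A0 * B0) (A1 * B0 + A0 * B1).
Proof.
move=> s0 s1 [A2 -> Ac] [B2 -> Bd].
(* The terms of order 3 and 4 in [s] are moved into the second-order coefficient, at no cost because
   [s <= 1]. *)
exists (A0 * B2 + A2 * B0 + A1 * B1 + s * (A1 * B2 + A2 * B1) + s ^+ 2 * (A2 * B2)).
  ring.
apply: le_trans (ler_pM _ _ Ac Bd); rewrite ?addr_ge0 //.
have s2 : s ^+ 2 <= 1 by rewrite expr_le1.
have n1 := ler_normD (A1 * B0) (A0 * B1).
have n2 : `|A0 * B2 + A2 * B0 + A1 * B1 + s * (A1 * B2 + A2 * B1) + s ^+ 2 * (A2 * B2)|
  <= `|A0 * B2| + `|A2 * B0| + `|A1 * B1| + (`|A1 * B2| + `|A2 * B1|) + `|A2 * B2|.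
  apply: le_trans (ler_normD _ _) _; apply: lerD; last first.
    by rewrite [leLHS]normrM ger0_norm ?sqr_ge0 // ler_piMl.
  apply: le_trans (ler_normD _ _) _; apply: lerD; last first.
    rewrite normrM ger0_norm //; apply: le_trans (ler_normD _ _).
    by rewrite ler_piMl.
  by apply: le_trans (ler_normD _ _) _; rewrite lerD2r ler_normD.
rewrite normrM; apply: le_trans (lerD (lerD (lexx _) n1) n2) _.
rewrite !normrM le_eqVlt; apply/orP; left; apply/eqP; ring.
Qed.

(** The truncated [j.-1] is harmless at [j = 0], where [*+ j] kills the term. *)
Lemma jetX s c A A0 A1 j : 0 <= s -> s <= 1 -> jet s c A A0 A1 ->
  jet s (c ^+ j) (A ^+ j) (A0 ^+ j) (A0 ^+ j.-1 * A1 *+ j).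
Proof.
move=> s0 s1 J; elim: j => [|j IH].
  exists 0; first by rewrite !expr0 mulr0n !mulr0 !addr0.
  by rewrite !expr0 mulr0n normr0 !addr0 normr1.
have := jetM s0 s1 J IH; rewrite -!exprS /=.
congr jet; case: j {IH} => [|j]; first by rewrite mulr0n mulr0 addr0 mulrC.
by rewrite [RHS]mulrS mulrnAr mulrA -exprS [A1 * _]mulrC.
Qed.

Lemma jet_prod (I : eqType) (r : seq I) s (c A A0 A1 : I -> R) :
  0 <= s -> s <= 1 -> uniq r ->
  (forall i, jet s (c i) (A i) (A0 i) (A1 i)) ->
  jet s (\prod_(i <- r) c i) (\prod_(i <- r) A i) (\prod_(i <- r) A0 i)
    (\sum_(i <- r) A1 i * \prod_(j <- r | j != i) A0 j).
Proof.
move=> s0 s1 + J; elim: r => [|i r IH] /= => [_|/andP[ir /IH {}IH]].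
  by rewrite !big_nil; exists 0; rewrite ?mulr0 ?addr0 // normr0 normr1 !addr0.
have := jetM s0 s1 (J i) IH; rewrite -!(big_cons _ _ i r xpredT).
rewrite !big_cons eqxx /=; congr jet; congr (_ + _).
  congr (_ * _); rewrite big_seq [RHS]big_seq_cond; apply: eq_bigl => j.
  by have [jr|] := boolP (j \in r); rewrite ?andbF //=; apply/esym; apply: contraNneq ir => <-.
rewrite mulr_sumr; apply: eq_big_seq => j jr.
rewrite big_cons ifT; last by apply: contraNneq ir => ->.
by rewrite mulrCA.
Qed.

End Jets.

(** * Partial derivatives and Taylor remainder of monomials *)

Section MonomialDerivative.
Variables (R : realType) (n : nat).
Implicit Types (x y v : 'rV[R]_n) (be : multiindex n).

(** Truncated subtraction: if [be i = 0] the result is [be] itself, but then the factor [be i] of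
    [pdmonomial] vanishes. *)
Definition lower (i : 'I_n) be : multiindex n := [ffun j => be j - (j == i)]%N.

Definition pdmonomial i be y : R := (be i)%:R * monomial (lower i be) y.

Lemma degree_lower i be : be i != 0 -> degree be = (degree (lower i be)).+1.
Proof.
move=> bi; rewrite /degree (bigD1 i) //= [in RHS](bigD1 i) //= ffunE eqxx.
rewrite -addSn subn1 prednK ?lt0n //; congr addn.
by apply: eq_bigr => j /negPf ji; rewrite ffunE ji subn0.
Qed.

(** The power of 2 pays for the factor [be i]; the base [|y| + 1] is at least 1, so the lowered
    degree may be raised back to [degree be]. *)
Lemma norm_pdmonomial_le i be y : `|pdmonomial i be y| <= (2 * (`|y| + 1)) ^+ degree be.
Proof.
rewrite /pdmonomial normrM normr_nat exprMn.
have y1 : 1 <= `|y| + 1 by rewrite lerDr.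
apply: ler_pM => //.
  rewrite -natrX ler_nat; apply: leq_trans (ltnW (ltn_expl _ (ltnSn 1))) _.
  by rewrite leq_exp2l // /degree (bigD1 i) //= leq_addr.
apply: le_trans (norm_monomial_le (z := `|y| + 1) _ _) _; first by rewrite lerDl.
rewrite ler_weXn2l // /degree leq_sum // => j _.
by rewrite ffunE leq_subr.
Qed.

(** With [v = s * u] and [|u i| <= 1], each coordinate of [y + v] is a jet in [s] with bound
    [|y| + 1]; multiplying jets gives the bound for the monomial. *)
Lemma monomial_taylor be y v : `|v| <= 1 ->
  `|monomial be (y + v) - monomial be y - \sum_i v 0 i * pdmonomial i be y|
    <= `|v| ^+ 2 * (`|y| + 1) ^+ degree be.
Proof.
move=> v1; set s := `|v|; have s_ge0 : 0 <= s by exact: normr_ge0.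
have [u uv u1] : exists2 u : 'I_n -> R, forall i, v 0 i = s * u i & forall i, `|u i| <= 1.
  (* For [v = 0] the division by zero yields [u = 0], which serves as well. *)
  exists (fun i => v 0 i / s) => i; have vi : `|v 0 i| <= s := ler_norm_coord v i.
    have [s0|s0] := eqVneq s 0; last by rewrite mulrCA divff // mulr1.
    by move: vi; rewrite s0 normr_le0 => /eqP ->; rewrite mul0r.
  have [s0|s0] := eqVneq s 0; first by rewrite s0 invr0 mulr0 normr0.
  have sp : 0 < s by rewrite lt_def s0 normr_ge0.
  by rewrite normrM normfV (gtr0_norm sp) ler_pdivrMr ?mul1r.
have Ji i : jet s ((`|y| + 1) ^+ be i) ((y + v) 0 i ^+ be i) (y 0 i ^+ be i)
    (y 0 i ^+ (be i).-1 * u i *+ be i).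
  apply: (jetX _ s_ge0 v1); exists 0; first by rewrite mxE uv mulr0 addr0.
  by rewrite normr0 addr0 lerD // ler_norm_coord.
have := jet_prod (r := index_enum 'I_n) s_ge0 v1 (index_enum_uniq _) Ji.
rewrite prodrXr -/(monomial be (y + v)) -/(monomial be y) -/(degree be).
set A1 := \sum_(i <- _) _; case=> A2 -> Ac.
have -> : \sum_i v 0 i * pdmonomial i be y = s * A1.
  rewrite mulr_sumr; apply: eq_bigr => i _.
  rewrite /pdmonomial /monomial uv -!mulrA; congr (_ * _).
  rewrite (bigD1 i) //= ffunE eqxx subn1 -mulr_natl.
  rewrite (eq_bigr (fun j => y 0 j ^+ be j)) => [|j /negPf ji]; first by ring.
  by rewrite ffunE ji subn0.
set P := monomial be y.
have -> : P + s * A1 + s ^+ 2 * A2 - P - s * A1 = s ^+ 2 * A2 by ring.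
rewrite normrM ger0_norm ?sqr_ge0 // ler_wpM2l ?sqr_ge0 //.
by apply: le_trans Ac; rewrite lerDr addr_ge0.
Qed.

End MonomialDerivative.

(** * Differentiability and gradient from a quadratic remainder *)

Section Differential.
Variables (R : realType) (n : nat).
Implicit Types (y v : 'rV[R]_n).

Definition linform (g : 'I_n -> R) v : R := \sum_i v 0 i * g i.

Lemma linform_is_linear g : linear (linform g).
Proof.
move=> b u v; rewrite /linform scaler_sumr -big_split /=.
by apply: eq_bigr => i _; rewrite !mxE mulrDl -mulrA.
Qed.

HB.instance Definition _ g :=
  GRing.isLinear.Build R 'rV[R]_n R _ (linform g) (linform_is_linear g).

Lemma linform_continuous g : continuous (linform g).
Proof.
apply: continuous_big => [|i _ v]; first exact: add_continuous.
apply: (@cvgMr_tmp _ _ (nbhs v) _ (fun v : 'rV[R]_n => v 0 i)).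
exact: (@coord_continuous R 1 n 0 i v).
Qed.

Lemma grad_quadratic_approx (f : 'rV[R]_n -> R) (g : 'I_n -> R) (C : R) y :
  (forall v, `|v| <= 1 ->
    `|f (y + v) - f y - \sum_i v 0 i * g i| <= `|v| ^+ 2 * C) ->
  differentiable f y /\ grad f y = \row_i g i.
Proof.
move=> fg.
have E : f \o shift y = cst (f y) + linform g +o_ (0 : 'rV[R]_n) id.
  apply/eqaddoP => e e0.
  have C1 : 0 < `|C| + 1 by rewrite ltr_wpDl.
  have : \forall v \near (0 : 'rV[R]_n), `|v| < Num.min 1 (e / (`|C| + 1)).
    have d0 : 0 < Num.min 1 (e / (`|C| + 1)) by rewrite lt_min ltr01 divr_gt0.
    apply/nbhs_ballP; exists (Num.min 1 (e / (`|C| + 1))) => // v.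
    by rewrite -ball_normE /= sub0r normrN.
  apply: filterS => v; rewrite lt_min => /andP[v1 ve].
  have -> : (f \o shift y - (cst (f y) + linform g)) v = f (y + v) - f y - \sum_i v 0 i * g i.
    by rewrite -[LHS]/(f (v + y) - (f y + linform g v)) opprD addrA [v + y]addrC.
  apply: le_trans (fg _ (ltW v1)) _.
  rewrite expr2 -mulrA mulrC ler_wpM2r //.
  have := ltW ve; rewrite ler_pdivlMr // => H.
  apply: le_trans H; rewrite ler_wpM2l //.
  by apply: le_trans (ler_norm _) _; rewrite lerDl.
have dE := diff_unique (@linform_continuous g) E.
have df : differentiable f y.
  by apply/diff_locallyP; rewrite dE; split => //; exact: linform_continuous.
split=> //; apply/rowP => i; rewrite !mxE deriveE // dE /= /linform.
rewrite (bigD1 i) //= mxE !eqxx mul1r big1 ?addr0 // => j /negPf ji.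
by rewrite mxE ji andbF mul0r.
Qed.

End Differential.

(** * Geometric decay against factorial ratios *)

Section FactorialGrowth.
Variable R : realType.

(* One term of the binomial expansion of [((1 - r) + r) ^+ (j + p) = 1]. *)
Lemma exprn_fact_ratio_le (r : R) (p : nat) : 0 <= r -> r < 1 ->
  forall j, r ^+ j * ((j + p)`!%:R / j`!%:R) <= p`!%:R / (1 - r) ^+ p.
Proof.
move=> r0 r1 j; have s0 : 0 < 1 - r by rewrite subr_gt0.
have f0 m : 0 < m`!%:R :> R by rewrite ltr0n fact_gt0.
have E : (j + p)`!%:R / j`!%:R = p`!%:R * 'C(j + p, j)%:R :> R.
  apply: (mulIf (lt0r_neq0 (f0 j))).
  rewrite divfK ?gt_eqF // -!natrM -(bin_fact (leq_addr p j)) addKn.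
  by rewrite mulnCA mulnC [('C(_, _) * _)%N]mulnC.
rewrite E mulrCA ler_wpM2l ?ler0n // -div1r ler_pdivlMr ?exprn_gt0 //.
have : \sum_(i < (j + p).+1) ((1 - r) ^+ (j + p - i) * r ^+ i) *+ 'C(j + p, i) = 1.
  by rewrite -exprDn subrK expr1n.
have jp : (j < (j + p).+1)%N by rewrite ltnS leq_addr.
rewrite (bigD1 (Ordinal jp)) //= addKn => E1; rewrite -[leRHS]E1.
rewrite -[X in _ <= X + _]mulr_natr [leLHS]mulrC mulrA lerDl.
by apply: sumr_ge0 => i _; rewrite mulrn_wge0 // mulr_ge0 // exprn_ge0 // ltW.
Qed.

(** Write [q = r * r]. The ratio [X] is at least 1, so its root is at most [X], and [j.+1 * X] is at
    most the factorial ratio for [p.+1]. One [r ^+ j] absorbs that ratio; the other remains. *)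
Lemma sqrt_fact_ratio_le (q : R) (p : nat) : 0 <= q -> q < 1 ->
  exists2 B, 0 <= B & forall j,
    q ^+ j * (j.+1%:R * (Num.sqrt (j + p)`!%:R / Num.sqrt j`!%:R))
      <= B * Num.sqrt q ^+ j.
Proof.
move=> q0 q1; set r := Num.sqrt q.
have r0 : 0 <= r by exact: sqrtr_ge0.
have r1 : r < 1 by rewrite -sqrtr1 ltr_sqrt.
exists (p.+1`!%:R / (1 - r) ^+ p.+1) => [|j].
  by rewrite divr_ge0 // exprn_ge0 // subr_ge0 ltW.
rewrite -(sqr_sqrtr q0) -/r -exprM mulnC exprM expr2 -mulrA mulrC ler_wpM2r ?exprn_ge0 //.
apply: le_trans (exprn_fact_ratio_le p.+1 r0 r1 j).
rewrite ler_wpM2l ?exprn_ge0 //.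
have f0 m : 0 < m`!%:R :> R by rewrite ltr0n fact_gt0.
set X := (j + p)`!%:R / j`!%:R : R.
have X1 : 1 <= X by rewrite ler_pdivlMr // mul1r ler_nat leq_fact // leq_addr.
have X0 : 0 <= X by apply: le_trans X1.
rewrite -sqrtrV ?ler0n // -sqrtrM ?ler0n // -/X.
apply: (@le_trans _ _ (j.+1%:R * X)).
  rewrite ler_wpM2l // -[leRHS](sqr_sqrtr X0) expr2 ler_peMl ?sqrtr_ge0 //.
  by rewrite -sqrtr1 ler_wsqrtr.
rewrite addnS factS natrM -mulrA ler_wpM2r // ler_nat ltnS leq_addr //.
Qed.

End FactorialGrowth.

(** * Norm limits of finite rank operators *)

Section FiniteRankApproximation.
Variables (R : realType) (n : nat) (H : rkhs R n).
Local Notation "''[' u , v ]" := (inner H u v) : ring_scope.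
Implicit Types A : H -> H.

Definition fin_rank (s : seq (H * H)) (h : H) : H := \sum_(p <- s) '[h, p.1] *: p.2.

(** The operator norm closure of the finite rank operators, phrased for bare maps. *)
Definition approximable A := forall e : R, 0 < e ->
  exists s, forall h, `|A h - fin_rank s h| <= e * `|h|.

Lemma approximable_ext A A' : A =1 A' -> approximable A -> approximable A'.
Proof. by move=> /funext ->. Qed.

Lemma approximable0 : approximable (fun=> 0).
Proof.
move=> e e0; exists [::] => h.
by rewrite /fin_rank big_nil subrr normr0 mulr_ge0 // ltW.
Qed.

Lemma approximableD A A' : approximable A -> approximable A' ->
  approximable (fun h => A h + A' h).
Proof.
move=> HA HA' e e0; have e2 : 0 < e / 2 by rewrite divr_gt0.
have [s Hs] := HA _ e2; have [s' Hs'] := HA' _ e2.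
exists (s ++ s') => h; rewrite /fin_rank big_cat /= -!/(fin_rank _ _).
rewrite opprD addrACA [e]splitr mulrDl; apply: le_trans (ler_normD _ _) _.
exact: lerD.
Qed.

Lemma approximableZ (t : R) A : approximable A -> approximable (fun h => t *: A h).
Proof.
move=> HA e e0; have t1 : 0 < `|t| + 1 by rewrite ltr_wpDl.
have [s Hs] := HA _ (divr_gt0 e0 t1).
exists [seq (p.1, t *: p.2) | p <- s] => h.
have -> : fin_rank [seq (p.1, t *: p.2) | p <- s] h = t *: fin_rank s h.
  rewrite /fin_rank big_map scaler_sumr; apply: eq_bigr => p _ /=.
  by rewrite !scalerA mulrC.
rewrite -scalerBr normrZ; apply: le_trans (ler_wpM2l (normr_ge0 _) (Hs h)) _.
rewrite mulrA ler_wpM2r // mulrCA ler_piMr ?(ltW e0) //.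
by rewrite ler_pdivrMr // mul1r lerDl.
Qed.

Lemma approximable_sum (I : Type) (r : seq I) (A : I -> H -> H) :
  (forall i, approximable (A i)) -> approximable (fun h => \sum_(i <- r) A i h).
Proof.
move=> HA; elim: r => [|i r IH].
  by apply: approximable_ext approximable0 => h; rewrite big_nil.
by apply: approximable_ext (approximableD (HA i) IH) => h; rewrite big_cons.
Qed.

Lemma approximable_lim A :
  (forall e, 0 < e -> exists2 A', approximable A' &
    forall h, `|A h - A' h| <= e * `|h|) -> approximable A.
Proof.
move=> HA e e0; have e2 : 0 < e / 2 by rewrite divr_gt0.
have [A' /(_ _ e2)[s Hs] AA'] := HA _ e2.
exists s => h; rewrite -(subrKA (A' h)) [e]splitr mulrDl.
by apply: le_trans (ler_normD _ _) _; exact: lerD.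
Qed.

(** The finite set [J] that cuts the tail depends on [e] alone and serves all [h]; this turns the
    pointwise sum into a norm limit. *)
Lemma approximable_psum (I : choiceType) (G : I -> R) (M : R)
    (F : I -> H -> H) (A : H -> H) :
  (forall J : {fset I}, psum G J <= M) ->
  (forall i h, `|F i h| <= `|h| * G i) ->
  (forall h, psum (F^~ h) @ totally --> A h) ->
  (forall i, approximable (F i)) -> approximable A.
Proof.
move=> GM FG FA Fa; apply: approximable_lim => e e0.
have [J HJ] := psum_tail_small GM e0.
exists (fun h => \sum_(i <- J) F i h); first exact: approximable_sum.
move=> h; rewrite -psumE mulrC.
by apply: psum_lim_tail (FA h) => //; exact: HJ.
Qed.

End FiniteRankApproximation.

(** * Differentiability in the space and the operators attached to [x^al] and [d_i] *)

Section Operators.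
Variables (R : realType) (n : nat) (H : rkhs R n).
Variables (k : 'rV[R]_n -> H).
Hypothesis k_eval : forall x, represents_eval x (k x).
Hypothesis k_inner : forall x y, expR (dotprod x y) = inner H (k y) (k x).
Variable mon : multiindex n -> H.
Hypothesis monE : forall be x, rkhs_fun (mon be) x = monomial be x.
Hypothesis mon_norm : forall be, `|mon be| ^+ 2 <= mfact R be.
Implicit Types (x y v : 'rV[R]_n) (al be : multiindex n) (h : H).
Local Notation "''[' u , v ]" := (inner H u v) : ring_scope.
Local Notation coef := (taylor_coef mon).

(** At [y + v] the Taylor remainder of index [be] is at most
    [|v| ^+ 2 * |h| * B * 2^-1 ^+ degree be]. Summing the geometric series leaves a quadratic
    remainder with a constant independent of [v]. *)
Lemma rkhs_fun_differentiable h y : differentiable (rkhs_fun h) y /\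
  forall i, psum (fun be => coef h be * pdmonomial i be y) @ totally
              --> grad (rkhs_fun h) y 0 i.
Proof.
have half0 : 0 <= 2^-1 :> R by lra.
have half1 : 2^-1 < 1 :> R by lra.
have y0 : 0 <= `|y| + 1 by rewrite addr_ge0.
have /choice[g gP] i : exists g : R,
    psum (fun be => coef h be * pdmonomial i be y) @ totally --> g.
  have [|B B0 HB] := @degree_sqrt_mfact_le R n (2 * (`|y| + 1)); first exact: mulr_ge0.
  apply: (psum_geometric_cvg (r := 2^-1) (c := `|h| * B)) => // [|be].
    exact: mulr_ge0.
  rewrite normrM -mulrA; apply: le_trans (ler_wpM2l (normr_ge0 h) (HB be)).
  rewrite mulrA mulrAC ler_pM //; first exact: taylor_coef_le.
  exact: norm_pdmonomial_le.
have [B B0 HB] := @degree_sqrt_mfact_le R n _ y0.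
have [|df gE] := @grad_quadratic_approx R n (rkhs_fun h) g (`|h| * B * (1 - 2^-1)^-1 ^+ n) y.
  move=> v v1.
  pose D be := coef h be *
    (monomial be (y + v) - monomial be y - \sum_i v 0 i * pdmonomial i be y).
  have L : psum D @ totally --> rkhs_fun h (y + v) - rkhs_fun h y - \sum_i v 0 i * g i.
    have -> : psum D = fun A => psum (fun be => coef h be * monomial be (y + v)) A
       - psum (fun be => coef h be * monomial be y) A
       - \sum_i v 0 i * psum (fun be => coef h be * pdmonomial i be y) A.
      apply/funext => A.
      have -> : \sum_i v 0 i * psum (fun be => coef h be * pdmonomial i be y) A =
          psum (fun be => coef h be * \sum_i v 0 i * pdmonomial i be y) A.
        rewrite psumE; under eq_bigr => i _ do rewrite psumE mulr_sumr.
        rewrite exchange_big /=; apply: eq_bigr => be _; rewrite mulr_sumr.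
        by apply: eq_bigr => i _; rewrite mulrCA.
      rewrite !psumE -!sumrB; apply: eq_bigr => be _.
      by rewrite /D !mulrBr.
    apply: cvgB; first by apply: cvgB; exact: rkhs_fun_expansion.
    apply: cvg_big => [|i _]; first exact: add_continuous.
    by apply: cvgMr; exact: gP.
  rewrite mulrA.
  apply: (psum_lim_le (fun A => psum_geometric_le A half0 half1) _ _ L).
    move=> be; rewrite /D normrM.
    have DE := ler_pM _ _ (taylor_coef_le mon_norm h be) (monomial_taylor be y v1).
    apply: le_trans (DE _ _) _ => //.
    rewrite mulrCA -!mulrA ler_wpM2l ?sqr_ge0 // ler_wpM2l //.
    by rewrite ler_wpM2l // [leLHS]mulrC HB.
  by rewrite !mulr_ge0 ?sqr_ge0.
by split=> // i; rewrite gE mxE.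
Qed.

Definition madd al be : multiindex n := [ffun j => al j + be j]%N.

Lemma monomial_madd al be x : monomial (madd al be) x = monomial al x * monomial be x.
Proof.
by rewrite /monomial -big_split /=; apply: eq_bigr => i _; rewrite ffunE exprD.
Qed.

Lemma monomial_scale be (a : R) x : monomial be (a *: x) = a ^+ degree be * monomial be x.
Proof.
rewrite /monomial -prodrXr -big_split /=.
by apply: eq_bigr => i _; rewrite mxE exprMn.
Qed.

Variable a : R.
Hypothesis a_lt1 : `|a| < 1.

(** Every factor is bounded by a product over the coordinates, in particular [be i] by the product
    of all [(be j).+1], so that the one-variable bound applies coordinate by coordinate. *)
Lemma shifted_coef_le i al : exists2 B, 0 <= B & forall h be,
  `|(a ^+ degree be * (be i)%:R * coef h be) *: mon (madd al (lower i be))|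
    <= `|h| * (B * Num.sqrt `|a| ^+ degree be).
Proof.
have /choice[B BP] j : exists B, 0 <= B /\ forall m,
    `|a| ^+ m * (m.+1%:R * (Num.sqrt (m + al j)`!%:R / Num.sqrt m`!%:R))
      <= B * Num.sqrt `|a| ^+ m.
  by have [B B0 HB] := sqrt_fact_ratio_le (al j) (normr_ge0 a) a_lt1; exists B.
have B0 j := (BP j).1; have HB j := (BP j).2.
exists (\prod_j B j) => [|h be]; first exact: prodr_ge0.
rewrite normrZ (normrM _ (coef h be)) (normrM (a ^+ _)) normr_nat normrX.
have bi : (be i)%:R <= \prod_j (be j).+1%:R :> R.
  rewrite -natr_prod ler_nat (bigD1 i) //=.
  by apply: leq_trans (leqnSn _) (leq_pmulr _ _); apply: prodn_gt0.
have mb : `|mon (madd al (lower i be))| <= \prod_j Num.sqrt (be j + al j)`!%:R.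
  rewrite -sqrtr_prod //; apply: le_trans (norm_mon_le mon_norm _) _.
  rewrite ler_wsqrtr //; apply: ler_prod => j _.
  rewrite ler0n ler_nat leq_fact // !ffunE addnC leq_add2r leq_subr //.
have bm0 : 0 <= (be i)%:R * `|mon (madd al (lower i be))| by rewrite mulr_ge0.
have H1 := ler_wpM2l (exprn_ge0 (degree be) (normr_ge0 a))
  (ler_pM bm0 (normr_ge0 _) (ler_pM (ler0n _ _) (normr_ge0 _) bi mb)
    (taylor_coef_le mon_norm h be)).
have -> : `|a| ^+ degree be * (be i)%:R * `|coef h be| * `|mon (madd al (lower i be))| =
  `|a| ^+ degree be * ((be i)%:R * `|mon (madd al (lower i be))| * `|coef h be|) by ring.
apply: le_trans H1 _.
have -> : `|a| ^+ degree be * (\prod_j (be j).+1%:R * \prod_j Num.sqrt (be j + al j)`!%:R *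
   (`|h| / Num.sqrt (mfact R be))) = `|h| * \prod_j
   (`|a| ^+ be j * ((be j).+1%:R * (Num.sqrt (be j + al j)`!%:R / Num.sqrt (be j)`!%:R))).
  by rewrite /mfact sqrtr_prod // !big_split /= prodrXr prodfV; ring.
rewrite ler_wpM2l // -prodrXr -big_split /=; apply: ler_prod => j _.
by rewrite HB andbT !mulr_ge0 ?invr_ge0.
Qed.

Lemma monomial_operator i al : exists T : H -> H,
  [/\ exists2 M, 0 <= M & forall h, `|T h| <= M * `|h|,
      approximable T &
      forall h x, rkhs_fun (T h) x =
        a * (monomial al x * grad (rkhs_fun h) (a *: x) 0 i)].
Proof.
have [B B0 HB] := shifted_coef_le i al.
pose F be h := (a ^+ degree be * (be i)%:R * coef h be) *: mon (madd al (lower i be)).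
set r := Num.sqrt `|a|.
have r0 : 0 <= r by exact: sqrtr_ge0.
have r1 : r < 1 by rewrite -sqrtr1 ltr_sqrt.
have GM J : psum (fun be => B * r ^+ degree be) J <= B * (1 - r)^-1 ^+ n.
  have := ler_wpM2l B0 (psum_geometric_le J r0 r1).
  by rewrite !psumE mulr_sumr.
have /choice[T TP] h : exists Th : H, psum (F^~ h) @ totally --> Th.
  exact: (psum_cvg GM (HB h)).
exists T; split.
- exists (B * (1 - r)^-1 ^+ n) => [|h].
    by rewrite mulr_ge0 // exprn_ge0 // invr_ge0 subr_ge0 ltW.
  by rewrite mulrC; apply: (psum_lim_le GM (HB h) _ (TP h)).
- apply: (approximable_psum GM _ TP) => [be h|be]; first exact: HB.
  (* Each [F be] is exactly of rank one: its coefficient is the inner product of [h] with [w]. *)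
  move=> e e0; pose w := (a ^+ degree be * (be i)%:R / mfact R be) *: mon be.
  exists [:: (w, mon (madd al (lower i be)))] => h.
  rewrite /fin_rank big_seq1 /= innerZr /F /taylor_coef.
  have -> : a ^+ degree be * (be i)%:R / mfact R be * '[h, mon be] =
    a ^+ degree be * (be i)%:R * ('[h, mon be] / mfact R be) by ring.
  by rewrite subrr normr0 mulr_ge0 // ltW.
- move=> h x.
  have L1 : (fun A => rkhs_fun (psum (F^~ h) A) x) @ totally --> rkhs_fun (T h) x.
    by apply: rkhs_fun_cvg (TP h).
  have L2 : (fun A => a * (monomial al x *
      psum (fun be => coef h be * pdmonomial i be (a *: x)) A)) @ totally -->
      a * (monomial al x * grad (rkhs_fun h) (a *: x) 0 i).
    do 2!apply: cvgMr; exact: (rkhs_fun_differentiable h (a *: x)).2.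
  suff E : (fun A => rkhs_fun (psum (F^~ h) A) x) = (fun A => a * (monomial al x *
      psum (fun be => coef h be * pdmonomial i be (a *: x)) A)).
    by rewrite E in L1; exact: (cvg_unique _ L1 L2).
  apply/funext => A; rewrite !psumE (rkhs_fun_sum k_eval) !mulr_sumr.
  apply: eq_bigr => be _.
  rewrite (rkhs_funZ k_eval) monE monomial_madd /pdmonomial monomial_scale.
  (* If [be i = 0] both sides vanish. Otherwise lowering drops the degree by exactly one, which
     accounts for the leading factor [a]. *)
  have [->|bi] := eqVneq (be i) 0%N; first by ring.
  by rewrite (degree_lower bi) exprS; ring.
Qed.

End Operators.

(** * Precompactness by approximation with compact sets *)

Section Compactness.
Variable R : realType.

(** An ultrafilter on the closure of [S] is pushed into [K] by choosing nearby points. The image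
    clusters at some [q], so the ultrafilter contains a small ball around [q]; it is therefore
    Cauchy and converges. *)
Lemma precompact_near_compact (V : completeNormedModType R) (S : set V) :
  (forall e : R, 0 < e -> exists2 K : set V, compact K &
    forall y, S y -> exists2 z, K z & `|y - z| <= e) ->
  precompact S.
Proof.
move=> SK; rewrite precompactE compact_ultra => F FU FS.
have cF : cauchy F.
  apply: cauchy_exP => e e0.
  have e3 : 0 < e / 3 by rewrite divr_gt0.
  have [K cK SK3] := SK _ e3.
  (* One [e / 3] leads from the closure into [S], the other from [S] to [K]. *)
  have /choice[p pP] y : exists z, closure S y -> K z /\ `|y - z| <= 2 * (e / 3).
    have [Sy|] := pselect (closure S y); last by exists 0.
    have [s [Ss]] := Sy _ (nbhsx_ballx y _ e3).
    rewrite -ball_normE /= => ys; have [z Kz sz] := SK3 _ Ss.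
    exists z => _; split=> //; rewrite -(subrKA s).
    by apply: le_trans (ler_normD _ _) _; lra.
  have pFK : F (p @^-1` K) by apply: filterS FS => y Sy; exact: (pP y Sy).1.
  have [q [Kq clq]] := cK _ (fmap_proper_filter p _) pFK.
  (* An ultrafilter contains the preimage of the ball or its complement; the complement would
     contradict the clustering at [q]. *)
  exists q; have [Fb|Fb] := in_ultra_setVsetC (p @^-1` ball q (e / 3)) FU.
    apply: filterS2 Fb FS => y /=; rewrite -!ball_normE /= => qy /pP[_ yp].
    rewrite -(subrKA (p y)); apply: le_lt_trans (ler_normD _ _) _.
    by move: yp; rewrite distrC; lra.
  have [z [/= zb bz]] := clq (~` ball q (e / 3)) _ Fb (nbhsx_ballx q _ e3).
  by case: zb.
have /cvg_ex[l Fl] : cvg F by exact: cauchy_cvg.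
exists l; split=> //.
by apply: (closed_cvg _ (@closed_closure _ S)) Fl => //.
Qed.

End Compactness.

(** * Finite rank operators and their norm limits on bounded sets *)

Section CompactOperators.
Variables (R : realType) (n : nat) (H : rkhs R n).
Local Notation "''[' u , v ]" := (inner H u v) : ring_scope.

(** By Cauchy-Schwarz each coefficient stays in a segment, so the values lie in a continuous image
    of a product of segments. *)
Lemma fin_rank_compact (s : seq (H * H)) (m : R) : exists2 K : set H, compact K &
  forall h, `|h| <= m -> K (fin_rank s h).
Proof.
elim: s => [|p s [K cK HK]].
  exists [set 0]; first exact: compact_set1.
  by move=> h _; rewrite /fin_rank big_nil.
exists ((fun q : R * H => q.1 *: p.2 + q.2) @`
    (`[- (m * `|p.1|), m * `|p.1|]%classic `*` K)).
  apply: continuous_compact; last by apply: compact_setX => //; exact: segment_compact.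
  apply: continuous_subspaceT => q.
  apply: cvgD; last exact: cvg_snd.
  by apply: cvgZr_tmp; exact: cvg_fst.
move=> h hm; exists ('[h, p.1], fin_rank s h); last by rewrite /fin_rank big_cons.
split=> /=; last exact: HK.
rewrite in_itv /= -ler_norml; apply: le_trans (inner_le _ _) _.
by rewrite ler_wpM2r.
Qed.

Lemma approximable_precompact (A : H -> H) (B : set H) :
  approximable A -> bounded_set B -> precompact (A @` B).
Proof.
move=> HA /ex_strict_bound_gt0[m m0 Bm].
apply: precompact_near_compact => e e0.
have [s Hs] := HA _ (divr_gt0 e0 m0).
have [K cK HK] := fin_rank_compact s m.
exists K => // _ [h Bh <-]; have hm := ltW (Bm _ Bh).
exists (fin_rank s h); first exact: HK.
apply: le_trans (Hs h) _.
by rewrite -mulrA ler_piMr ?(ltW e0) // mulrC ler_pdivrMr // mul1r.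
Qed.

End CompactOperators.

(** * Real bounds from summability; coordinates and the Euclidean norm *)

Section Summable.
Variables (R : realType).

Lemma summable_psum_le (I : choiceType) (g : I -> R) : (forall i, 0 <= g i) ->
  summable [set: I] (fun i => (g i)%:E) ->
  exists M, forall J : {fset I}, psum g J <= M.
Proof.
move=> g0 sg; exists (fine (\esum_(i in [set: I]) `|(g i)%:E|)%E) => J.
rewrite -lee_fin fineK; last first.
  by rewrite ge0_fin_numE // esum_ge0.
apply: esum_ge; exists [set` J]; first by split.
rewrite fsbig_finite //= set_fsetK psumE -sumEFin.
by apply: lee_sum => i _; rewrite lee_fin ler_norm.
Qed.

Variable n : nat.
Implicit Types x y : 'rV[R]_n.

Lemma dotprodE x y : dotprod x y = \sum_i x 0 i * y 0 i.
Proof. by rewrite /dotprod mxE; apply: eq_bigr => i _; rewrite mxE. Qed.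

Lemma coord_le_enorm x i : `|x 0 i| <= enorm x.
Proof.
rewrite /enorm -sqrtr_sqr ler_wsqrtr // dotprodE (bigD1 i) //= -expr2 lerDl.
by apply: sumr_ge0 => j _; rewrite -expr2 sqr_ge0.
Qed.

End Summable.

(** * Reduction to an everywhere defined map realising the Liouville formula *)

Section Liouville.
Variables (R : realType) (n : nat) (H : rkhs R n).
Variables (f : 'rV[R]_n -> 'rV[R]_n) (a : R).
Hypothesis rkhs_diff : forall (h : H) x, differentiable (rkhs_fun h) x.

Lemma liouville_fun_linear b (g h : H) :
  liouville_fun f a (rkhs_fun (b *: g + h)) =
  (fun x => b * liouville_fun f a (rkhs_fun g) x + liouville_fun f a (rkhs_fun h) x).
Proof.
apply/funext => x; rewrite /liouville_fun.
suff -> : grad (rkhs_fun (b *: g + h)) (a *: x) =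
  b *: grad (rkhs_fun g) (a *: x) + grad (rkhs_fun h) (a *: x).
  rewrite !dotprodE [X in _ = X + _]mulrCA -mulrDr [b * _]mulr_sumr -big_split /=.
  congr (_ * _).
  by apply: eq_bigr => i _; rewrite !mxE mulrDl mulrA.
have -> : rkhs_fun (b *: g + h) = b *: rkhs_fun g + rkhs_fun h.
  by apply/funext => y; rewrite rkhs_fun_linear.
apply/rowP => i; rewrite !mxE.
have dv (u : H) : derivable (rkhs_fun u) (a *: x) (delta_mx 0 i).
  exact: diff_derivable.
by rewrite deriveD // ?deriveZ //; exact: derivableZ.
Qed.

Variable S : H -> H.
Hypothesis SE : forall h, rkhs_fun (S h) = liouville_fun f a (rkhs_fun h).

Lemma liouville_opE : liouville_op H f a = S.
Proof.
apply/funext => h; rewrite /liouville_op; apply: xget_unique; first exact: SE.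
by move=> g /= gE; apply: rkhs_fun_inj; rewrite gE SE.
Qed.

Lemma liouville_domE : liouville_dom H f a = [set: H].
Proof.
apply/seteqP; split=> // h _; split; first by move=> x; exact: rkhs_diff.
by exists (S h).
Qed.

Lemma liouville_bounded_compact (M : R) :
  (forall h, `|S h| <= M * `|h|) -> approximable S ->
  bounded_operator (liouville_dom H f a) (liouville_op H f a) /\
  compact_operator (liouville_dom H f a) (liouville_op H f a).
Proof.
move=> SM aS; rewrite liouville_domE liouville_opE.
have Slin : linear S.
  move=> b g h; apply: rkhs_fun_inj; apply/funext => x.
  by rewrite rkhs_fun_linear !SE liouville_fun_linear.
split; split=> //; first by exists M.
by move=> B; exact: approximable_precompact.
Qed.

End Liouville.

(** * Choice of the coefficients and summation over [al] *)

Unset Implicit Arguments.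

Theorem theorem1 (R : realType) (n : nat) (n_gt0 : (0 < n)%N)
    (F2 : rkhs R n) (F2_fock : is_bargmann_fock F2)
    (a : R) (a_lt1 : `|a| < 1) :
  exists C : multiindex n -> R,
    forall (f : 'rV[R]_n -> 'rV[R]_n) (c : multiindex n -> 'rV[R]_n),
      power_series_of f c ->
      summable [set: multiindex n] (fun al => (enorm (c al) * C al)%:E) ->
      bounded_operator (liouville_dom F2 f a) (liouville_op F2 f a) /\
      compact_operator (liouville_dom F2 f a) (liouville_op F2 f a).
Proof.
have [k [k_eval k_inner]] := F2_fock.
have /choice[mon monP] be : exists w : F2,
    (forall x, rkhs_fun w x = monomial be x) /\ `|w| ^+ 2 <= mfact R be.
  by have [w wE w_le] := monomial_in_space k_eval k_inner be; exists w.
have monE be := (monP be).1; have mon_norm be := (monP be).2.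
have /choice[T TP] (p : 'I_n * multiindex n) : exists T : F2 -> F2,
    [/\ exists2 M, 0 <= M & forall h, `|T h| <= M * `|h|,
      approximable T &
      forall h x, rkhs_fun (T h) x =
        a * (monomial p.2 x * grad (rkhs_fun h) (a *: x) 0 p.1)].
  exact: (monomial_operator k_eval k_inner monE mon_norm a_lt1).
have /choice[M MP] p : exists M, 0 <= M /\ forall h, `|T p h| <= M * `|h|.
  by have [[M M0 HM] _ _] := TP p; exists M.
pose C al := \sum_i M (i, al).
have C0 al : 0 <= C al by apply: sumr_ge0 => i _; exact: (MP _).1.
exists C => f c fc sc.
pose G al := enorm (c al) * C al.
have [K GK] : exists K, forall J, psum G J <= K.
  by apply: summable_psum_le => // al; rewrite mulr_ge0 // sqrtr_ge0.
pose F al h : F2 := \sum_i c al 0 i *: T (i, al) h.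
have FG al h : `|F al h| <= `|h| * G al.
  apply: le_trans (ler_norm_sum _ _ _) _.
  rewrite /G /C mulrCA !mulr_sumr; apply: ler_sum => i _.
  rewrite normrZ ler_pM ?coord_le_enorm // mulrC; exact: (MP _).2.
have /choice[S SP] h : exists Sh : F2, psum (F^~ h) @ totally --> Sh.
  exact: (psum_cvg GK (fun al => FG al h)).
have diff (h : F2) x := (rkhs_fun_differentiable k_eval k_inner monE mon_norm h x).1.
apply: (@liouville_bounded_compact _ _ _ _ _ diff S _ K) => [h|h|].
(* Both sides are limits of one net: the partial sums of [F al h] evaluated at [x] equal [a] times
   the partial sums of the series of [f] at [x] paired with the gradient. *)
- apply/funext => x; rewrite /liouville_fun.
  set g := grad _ _.
  have L1 : (fun A => rkhs_fun (psum (F^~ h) A) x) @ totally --> rkhs_fun (S h) x.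
    by apply: (rkhs_fun_cvg k_eval); exact: SP.
  pose P := psum (fun al => monomial al x *: c al).
  have L2 : (fun A => a * \sum_i g 0 i * P A 0 i) @ totally --> a * dotprod g (f x).
    rewrite dotprodE; apply: cvgMr.
    apply: cvg_big => [|i _]; first exact: add_continuous.
    apply: cvgMr; apply: (@cvg_comp _ _ _ P (fun y => y 0 i)) (fc x) _.
    exact: coord_continuous.
  suff E : (fun A => rkhs_fun (psum (F^~ h) A) x) = (fun A => a * \sum_i g 0 i * P A 0 i).
    by rewrite E in L1; exact: (cvg_unique _ L1 L2).
  apply/funext => A; rewrite psumE (rkhs_fun_sum k_eval).
  have -> : \sum_i g 0 i * P A 0 i = \sum_(al <- A) \sum_i g 0 i * (monomial al x * c al 0 i).
    rewrite exchange_big /=; apply: eq_bigr => i _.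
    rewrite /P psumE summxE mulr_sumr; apply: eq_bigr => al _.
    by congr (_ * _); rewrite mxE.
  rewrite mulr_sumr; apply: eq_bigr => al _.
  rewrite (rkhs_fun_sum k_eval) mulr_sumr; apply: eq_bigr => i _.
  have [_ _ TE] := TP (i, al).
  by rewrite (rkhs_funZ k_eval) TE /= -/g; ring.
- by rewrite mulrC; exact: (psum_lim_le GK (fun al => FG al h) _ (SP h)).
- apply: (approximable_psum GK FG SP) => al; apply: approximable_sum => i.
  by apply: approximableZ; have [] := TP (i, al).
Qed.
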